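(* The following statements hold (in ZFC) for every infinite metrizable space $X$. (1) If $w(X)=\omega$, then $X$ is compact if and only if $\mathsf{SC}(X)=\mathsf{SC}(\mathrm{CL}(X))$. (2) If $\mathrm{cf}(w(X))>\omega$, then $w(X)^+\in \mathsf{SC}(X)\setminus \mathsf{SC}(\mathrm{CL}(X))$. (3) If $w(X)>\omega$, $\mathrm{cf}(w(X))=\omega$, and $\mathfrak{c}>w(X)$, then $w(X)^+\in \mathsf{SC}(X)\setminus \mathsf{SC}(\mathrm{CL}(X))$. (4) There exists an ultrametrizable space $Y$ such that $w(Y)>\omega$, $\mathrm{cf}(w(Y))=\omega$, and, if the Generalized Continuum Hypothesis holds, then $\mathsf{SC}(Y)=\mathsf{SC}(\mathrm{CL}(Y))$.
   Context: $w(X)$ is the weight of $X$ (least cardinality of a base), $\mathfrak{c}=2^\omega$, $\mathrm{cf}$ is cofinality, $\mu^+$ is the successor cardinal of $\mu$. A space is ultrametrizable if its topology is induced by an ultrametric. Super calibers: an infinite cardinal $\kappa$ is a super caliber for a topological space $X$ (equivalently, $X$ has super caliber $\kappa$) if for all indexed families $(x_\alpha)_{\alpha<\kappa}$ of points of $X$ and $(U_\alpha)_{\alpha<\kappa}$ of open subsets of $X$ with $x_\alpha\in U_\alpha$ for each $\alpha<\kappa$, there is $J\subseteq\kappa$ with $|J|=\kappa$ such that $x_\alpha\in U_\beta$ for all $\alpha,\beta\in J$. $\mathsf{SC}(X)$ is the class of all infinite cardinals that are super calibers for $X$. $\mathrm{CL}(X)$ is the set of all nonempty closed subsets of $X$ with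 the Vietoris topology, whose base consists of the sets $\langle U_1,\dots,U_n\rangle=\{A\in\mathrm{CL}(X): A\subseteq U_1\cup\dots\cup U_n,\ A\cap U_i\neq\emptyset \text{ for all } i\}$ with $n\geq 1$ and $U_1,\dots,U_n$ open in $X$. *)

(* Defs.v *)
From HB Require Import structures.
From mathcomp Require Import all_boot all_order all_algebra.
From mathcomp Require Import all_classical wochoice reals topology.

Set Implicit Arguments.
Unset Strict Implicit.
Unset Printing Implicit Defensive.

Import Order.TTheory GRing.Theory Num.Theory.
Local Open Scope classical_set_scope.
Local Open Scope card_scope.
Local Open Scope ring_scope.

(* A cardinal is represented by any type of that cardinality; cardinals are
   compared with #<=, #< and #= on full sets [set: K], and a class of cardinals
   is a predicate [cardinal -> Prop] closed under equipotence.  The constant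
   [cardinal] pins down one universe, which contains [set X] for every space X;
   [set cardinal] would force it to be too small for that. *)
Definition cardinal := Type.

Definition card_lt T U (A : set T) (B : set U) : Prop :=
  A #<= B /\ ~ (B #<= A).
Notation "A '#<' B" := (card_lt A B)
  (at level 79, format "A  '#<'  B") : card_scope.

Definition is_least_card (P : cardinal -> Prop) (K : cardinal) : Prop :=
  P K /\ forall L : cardinal, P L -> [set: K] #<= [set: L].

(* The value [False] is only taken when P is empty, see [least_cardP]. *)
Definition least_card (P : cardinal -> Prop) : cardinal :=
  if pselect (exists K, is_least_card P K) is left h
  then projT1 (cid h) else False.

Definition card_succ (K : cardinal) : cardinal :=
  least_card (fun L => [set: K] #< [set: L]).

(* (K, R) has the order type of the initial ordinal |K|. *)
Definition initial_well_order (K : cardinal) (R : rel K) : Prop :=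
  well_order R /\ forall x, [set y | R y x /\ y <> x] #< [set: K].

Definition cofinal_in (K : cardinal) (R : rel K) (C : set K) : Prop :=
  forall x, exists2 y, C y & R x y.

(* All initial well-orders of K are isomorphic, so this does not depend on the
   choice of R. *)
Definition cofinality (K : cardinal) : cardinal :=
  least_card (fun L => exists R : rel K, initial_well_order R /\
                      exists2 C : set K, cofinal_in R C & [set: L] #= C).

Definition GCH : Prop :=
  forall K : cardinal, infinite_set [set: K] ->
    [set: card_succ K] #= [set: set K].

Definition weight (X : topologicalType) : cardinal :=
  least_card (fun L => exists2 B : set (set X), basis B & [set: L] #= B).

Definition super_caliber (X : topologicalType) (K : cardinal) : Prop :=
  forall (x : K -> X) (U : K -> set X),
    (forall a, open (U a)) -> (forall a, U a (x a)) ->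
    exists J : set K, J #= [set: K] /\
      forall a b, J a -> J b -> U b (x a).

Definition SC (X : topologicalType) (K : cardinal) : Prop :=
  infinite_set [set: K] /\ super_caliber X K.

Definition is_metric (R : realType) (T : Type) (d : T -> T -> R) : Prop :=
  [/\ forall x y, 0 <= d x y,
      forall x y, d x y = 0 <-> x = y,
      forall x y, d x y = d y x &
      forall x y z, d x z <= d x y + d y z].

Definition is_ultrametric (R : realType) (T : Type) (d : T -> T -> R) : Prop :=
  is_metric d /\ forall x y z, d x z <= Num.max (d x y) (d y z).

Definition induces_topology (R : realType) (X : topologicalType)
    (d : X -> X -> R) : Prop :=
  forall A : set X, open A <->
    forall x, A x -> exists2 e, 0 < e & [set y | d x y < e] `<=` A.

Definition metrizable (R : realType) (X : topologicalType) : Prop :=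
  exists2 d : X -> X -> R, is_metric d & induces_topology d.

Definition ultrametrizable (R : realType) (X : topologicalType) : Prop :=
  exists2 d : X -> X -> R, is_ultrametric d & induces_topology d.

Record CL (X : topologicalType) : Type := MkCL {
  CL_set :> set X ;
  CL_closed : closed CL_set ;
  CL_neq0 : CL_set !=set0
}.

HB.instance Definition _ (X : topologicalType) := gen_eqMixin (CL X).
HB.instance Definition _ (X : topologicalType) := gen_choiceMixin (CL X).

(* The basic set <U_0, ..., U_n>. *)
Definition vietoris (X : topologicalType) (n : nat) (U : 'I_n.+1 -> set X) :
    set (CL X) :=
  [set A : CL X | CL_set A `<=` \bigcup_i U i /\
                  forall i, CL_set A `&` U i !=set0].

Definition vietoris_base (X : topologicalType) : set (set (CL X)) :=
  [set V | exists (n : nat) (U : 'I_n.+1 -> set X),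
     (forall i, open (U i)) /\ V = vietoris U].

Lemma vietoris_base_cover (X : topologicalType) :
  \bigcup_(V in @vietoris_base X) V = setT.
Proof.
apply/seteqP; split=> // A _; exists (vietoris (fun _ : 'I_1 => setT)).
  by exists 0%N, (fun=> setT); split=> // _; exact: openT.
split; first by move=> x _; exists ord0.
by move=> _; rewrite setIT; exact: CL_neq0.
Qed.

Lemma vietoris_base_join (X : topologicalType) (V W : set (CL X)) (A : CL X) :
  vietoris_base V -> vietoris_base W -> V A -> W A ->
  exists V', [/\ vietoris_base V', V' A & V' `<=` V `&` W].
Proof.
move=> [n [U [oU ->]]] [m [U' [oU' ->]]] [AU AUi] [AU' AU'i].
pose F (k : 'I_(n.+1 + m.+1)) : set X :=
  match fintype.split k with
  | inl i => U i `&` \bigcup_j U' j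
  | inr j => \bigcup_i U i `&` U' j
  end.
have oUb : open (\bigcup_i U i) by exact: bigcup_open.
have oUb' : open (\bigcup_j U' j) by exact: bigcup_open.
have Fl i : F (lshift m.+1 i) = U i `&` \bigcup_j U' j.
  by rewrite /F -[lshift _ i]/(unsplit (inl i)) unsplitK.
have Fr j : F (@rshift n.+1 m.+1 j) = \bigcup_i U i `&` U' j.
  by rewrite /F -[rshift _ j]/(unsplit (inr j)) unsplitK.
exists (@vietoris X (n + m.+1) F); split.
- exists (n + m.+1)%N, F; split=> // k; rewrite /F.
  by case: fintype.split => i; exact: openI.
- split=> [x Ax|k].
    have [i _ Ux] := AU x Ax; exists (lshift m.+1 i) => //.
    by rewrite Fl; split=> //; exact: AU'.
  rewrite /F; case: fintype.split => i.
    by have [x [Ax Ux]] := AUi i; exists x; do 2?split=> //; exact: AU'.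
  by have [x [Ax Ux]] := AU'i i; exists x; do 2?split=> //; exact: AU.
- move=> B [BF BFk]; split; split.
  + move=> x /BF[k _]; rewrite /F.
    by case: fintype.split => i [? ?] //; exists i.
  + by move=> i; have [x] := BFk (lshift m.+1 i); rewrite Fl => -[? []]; exists x.
  + move=> x /BF[k _]; rewrite /F.
    by case: fintype.split => i [? ?] //; exists i.
  + by move=> j; have [x] := BFk (@rshift n.+1 m.+1 j); rewrite Fr => -[? []]; exists x.
Qed.

HB.instance Definition _ (X : topologicalType) :=
  isBaseTopological.Build (CL X) (@vietoris_base_cover X)
    (@vietoris_base_join X).

Lemma set_card_leP T U (A : set T) (B : set U) :
  A #<= B <-> exists f : A -> B, injective f.
Proof.
split=> [/card_leP[f]|[f fI]].
  by exists f => x y; apply: (@inj _ _ _ f); rewrite inE.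
by apply/card_leP/injfunPex; exists f => // x y _ _; exact: fI.
Qed.

Lemma type_card_leP K L :
  [set: K] #<= [set: L] <-> exists f : K -> L, injective f.
Proof.
split=> [/set_card_leP[f fI]|[f fI]].
  exists (fun x => val (f (SigSub (mem_set (I : [set: K] x))))) => x y.
  by move=> /val_inj/fI/(congr1 val).
apply/set_card_leP.
exists (fun x => SigSub (mem_set (I : [set: L] (f (val x))))) => x y.
by move=> /(congr1 val)/= /fI/val_inj.
Qed.

Lemma min_card (I : Type) (i0 : I) (A : I -> Type) :
  exists i, forall j, exists f : A i -> A j, injective f.
Proof.
pose P : set (set (forall i, A i)) :=
  [set F | forall f g i, F f -> F g -> f i = g i -> f = g].
have [C CP totC|F [PF Fmax]] := @Zorn_bigcup _ P.
  move=> f g i [F CF Ff] [G CG Gg].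
  have [FG|GF] := totC _ _ CF CG.
    by apply: (CP _ CG) => //; exact: FG.
  by apply: (CP _ CF) => //; exact: GF.
have [[i Fi]|/forallNP nF] :=
    pselect (exists i, forall a : A i, exists2 f, F f & f i = a).
  have /choice[h hF] a : exists f, F f /\ f i = a by have [f] := Fi a; exists f.
  exists i => j; exists (fun a => h a j) => a b hab.
  rewrite -(hF a).2 -(hF b).2.
  by rewrite (PF _ _ j (hF a).1 (hF b).1 hab).
have nFi i : {a : A i | forall f, F f -> f i <> a}.
  apply: cid; have /existsNP[a na] := nF i; exists a => f Ff fa.
  by apply: na; exists f.
pose g i := projT1 (nFi i).
have gF f i : F f -> f i <> g i by move=> Ff; exact: (projT2 (nFi i)).
have [] := Fmax (F `|` [set g]).
  split; first by move=> f; left.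
  by move=> /(_ g) /(_ (or_intror erefl)) /gF gF0; exact: (gF0 i0).
move=> f h i [Ff|->] [Fh|->] // fh; first exact: PF fh.
- by case: (gF f i).
- by case: (gF h i).
Qed.

Lemma card_le_total T U (A : set T) (B : set U) : A #<= B \/ B #<= A.
Proof.
have [[] h] := min_card true (fun b : bool => if b then A : Type else B : Type).
- by left; apply/set_card_leP; exact: (h false).
- by right; apply/set_card_leP; exact: (h true).
Qed.

Lemma type_card_le_set K0 L :
  [set: L] #<= [set: K0] -> exists S : set K0, [set: L] #= S.
Proof.
move=> /type_card_leP[f fI]; exists (range f).
by apply: card_esym; apply: inj_card_eq => x y _ _; exact: fI.
Qed.

Lemma least_cardP (P : cardinal -> Prop) :
  (exists K, P K) -> is_least_card P (least_card P).
Proof.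
move=> [K0 PK0]; rewrite /least_card; case: pselect => [h|[]].
  exact: (projT2 (cid h)).
pose I := {S : set K0 | exists2 K, P K & [set: K] #= S}.
have i0 : I by exists setT; exists K0.
have [[S [K PK KS]] minS] := min_card i0 (fun i : I => projT1 i : Type).
exists K; split=> // L PL.
have [LK0|K0L] := card_le_total [set: L] [set: K0]; last first.
  apply: card_le_trans K0L; apply: card_le_trans (card_leT S).
  by have [] := (card_eqPle _ _).1 KS.
have [S' LS'] := type_card_le_set LK0.
have SS' : S #<= S'.
  apply/set_card_leP.
  exact: (minS (exist _ S' (ex_intro2 _ _ L PL LS'))).
have [KS1 _] := (card_eqPle _ _).1 KS; have [_ S'L] := (card_eqPle _ _).1 LS'.
exact: card_le_trans KS1 (card_le_trans SS' S'L).
Qed.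

Lemma weightP (X : topologicalType) :
  is_least_card (fun L => exists2 B : set (set X), basis B & [set: L] #= B)
    (weight X).
Proof.
apply: least_cardP; exists (set_type (@open X)), open.
  split=> // x U; rewrite nbhsE => -[V [oV Vx] VU].
  by exists V.
apply/card_bijP; exists val, (fun u => SigSub (mem_set (I : setT u))).
  by move=> u; exact: val_inj.
by [].
Qed.

Lemma card_succP (K : cardinal) :
  is_least_card (fun L => [set: K] #< [set: L]) (card_succ K).
Proof.
apply: least_cardP; exists (set K); split.
  by apply/type_card_leP; exists set1 => x y xy; have : [set y] x by rewrite -xy.
move=> /type_card_leP[f fI].
pose D : set K := [set x | exists2 S, f S = x & ~ S x].
have nD : ~ D (f D) by move=> /[dup] DD [S /fI ->].
by apply: (nD); exists D.
Qed.

Lemma well_order_setP (K : Type) (R : rel K) : well_order R <->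
  forall A : set K, A !=set0 -> exists z, [/\ A z, forall y, A y -> R z y &
    forall t, A t -> (forall y, A y -> R t y) -> z = t].
Proof.
split=> [Rwo A [a Aa]|Rwo A [a Aa]].
  have [|z [[Az minz] uz]] := Rwo (mem A); first by exists a; exact: mem_set.
  exists z; split; [exact: set_mem|by move=> y /mem_set/minz|].
  by move=> t At mint; apply: uz; split=> [|y /set_mem/mint//]; exact: mem_set.
have [|z [Az minz uz]] := Rwo [set x | x \in A]; first by exists a.
by exists z; split=> [|t [At mint]]; [split|exact: uz].
Qed.

Lemma well_order_refl (K : Type) (R : rel K) : well_order R -> reflexive R.
Proof.
move=> /well_order_setP Rwo x.
by have [|_ [-> minx _]] := Rwo [set x]; [exists x|exact: minx].
Qed.

Lemma initial_well_order_ex (K : cardinal) :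
  exists R : rel K, initial_well_order R.
Proof.
have [R Rwo'] : exists R : rel K, well_order R.
  by elim/Peq: K => K; have [R] := well_ordering_principle K; exists R.
have Rxx := well_order_refl Rwo'; have /well_order_setP Rwo := Rwo'.
pose seg x := [set y | R y x /\ y <> x].
have [[x0 x0P]|/forallNP nS] := pselect (exists x, [set: K] #<= seg x); last first.
  by exists R; split=> // x; split; [exact: card_leT|exact: nS].
have [|x [xS minx _]] := Rwo [set x | [set: K] #<= seg x]; first by exists x0.
move: xS => /set_card_leP[g gI].
pose f a : K := val (g (SigSub (mem_set (I : [set: K] a)))).
have fI : injective f by move=> a b /val_inj/gI/(congr1 val).
have fx a : seg x (f a) by exact: set_mem (valP (g _)).
exists (fun a b => R (f a) (f b)); split.
  apply/well_order_setP => A [a Aa].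
  have [|_ [[b Ab <-] minz uz]] := Rwo (f @` A); first by exists (f a), a.
  exists b; split=> // [c Ac|c Ac minc]; first by apply: minz; exists c.
  by apply: fI; apply: uz => [|_ [e Ae <-]]; [exists c|exact: minc].
move=> a; split; first exact: card_leT.
move=> Ka; have Kfa : [set: K] #<= seg (f a).
  apply: card_le_trans Ka _; apply/set_card_leP.
  have sub (y : set_type [set b | R (f b) (f a) /\ b <> a]) : seg (f a) (f (val y)).
    by have [Ry ya] := set_mem (valP y); split=> // /fI.
  exists (fun y => SigSub (mem_set (sub y))) => y z.
  by move=> /(congr1 val)/= /fI/val_inj.
have [Rfa nfa] := fx a.
have [|z [_ _ uz]] := Rwo [set x; f a]; first by exists x; left.
have zx : z = x.
  by apply: uz => [|y [->|->]]; [left|exact: Rxx|exact: minx].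
have za : z = f a.
  by apply: uz => [|y [->|->]]; [right|exact: Rfa|exact: Rxx].
by apply: nfa; rewrite -za -zx.
Qed.

Lemma cofinalityP (K : cardinal) :
  is_least_card (fun L => exists R : rel K, initial_well_order R /\
                      exists2 C : set K, cofinal_in R C & [set: L] #= C)
    (cofinality K).
Proof.
apply: least_cardP; exists K.
have [R Rini] := initial_well_order_ex K; exists R; split=> //.
by exists setT => // x; exists x => //; exact: well_order_refl Rini.1 x.
Qed.

(* Main.v *)
From HB Require Import structures.
Require Import Defs.
From mathcomp Require Import all_boot all_order all_algebra.
From mathcomp Require Import all_classical reals topology.
From mathcomp Require Import zify ring lra.

(** A coloring [f : K -> C] has a full fiber if some fiber has the cardinality
    of [K].  If [X] has a network indexed by [C] and every [C]-coloring of [K]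
    has a full fiber, then [K] is a super caliber of [X]; conversely, if [X] has
    a discrete subspace indexed by [C], then every [C]-coloring of a super
    caliber has a full fiber.  Since [|w| * |w| = |w|], every coloring of
    [w(X)^+] with [w(X)] colors has a full fiber, so [w(X)^+] is a super caliber
    of [X].  If all subsets of [D] are closed in [X], then distinct subsets
    of [D] are separated on one side by the sets [<X \ (D \ A)>], so no infinite
    [K] of cardinality at most [2^|D|] is a super caliber of [CL X].  Such
    a [D] is found among the maximal [1/(n+1)]-separated sets: one of them has
    size [w(X)] when [cf(w(X)) > omega], and one of them is infinite when [w(X)]
    is uncountable.
    For (1), if [X] is compact with a countable base, finite lists of basic sets
    give a countable network of [CL X]; otherwise some infinite sequence in [X]
    has all its subsets closed.
    For (4), [Y] is a sequence of discrete spaces of sizes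
    [beth_0, beth_1, ...] converging to a point.  Then [Y] has a discrete
    subspace of size [beth_omega] and [CL Y] has a network of that size. *)

Set Implicit Arguments.
Unset Strict Implicit.
Unset Printing Implicit Defensive.

Import Order.TTheory GRing.Theory Num.Theory.
Local Open Scope classical_set_scope.
Local Open Scope card_scope.
Local Open Scope ring_scope.

(** * Cardinal arithmetic: squares, products and unions *)

Lemma card_leTP (K T : Type) (A : set T) :
  [set: K] #<= A <-> exists2 f : K -> T, injective f & forall k, A (f k).
Proof.
split=> [/set_card_leP[f fI]|[f fI fA]].
  exists (fun k => val (f (SigSub (mem_set (I : [set: K] k))))).
    by move=> x y /val_inj/fI/(congr1 val).
  by move=> k; exact: set_mem (valP _).
apply: (card_le_trans _ (_ : range f #<= A)); last first.
  by apply: subset_card_le => _ [k _ <-].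
by have [] := (card_eqPle _ _).1 (inj_card_eq (in2W fI) : range f #= setT).
Qed.

Lemma infinite_card_le (K L : Type) :
  infinite_set [set: K] -> [set: K] #<= [set: L] -> infinite_set [set: L].
Proof. by move=> Kinf KL /(card_le_finite KL). Qed.

(** The square bound is a hypothesis so that this can serve inside the proof of [card_sqr_le]. *)
Lemma card_sqr_bool (K : Type) :
  infinite_set [set: K] -> [set: K * K] #<= [set: K] ->
  [set: K * bool] #<= [set: K].
Proof.
move=> /infiniteP/type_card_leP[e eI]; apply: card_le_trans; apply/type_card_leP.
exists (fun u : K * bool => (u.1, e u.2)) => -[x b] [y c] [-> /eI].
by case: b c => -[].
Qed.

Section square.
Variable K : Type.
Implicit Types (G : set (K * K * K)).

Let dom G : set K := [set x | exists y z, G (x, y, z)].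

(* [G] is the graph of an injection from [dom G * dom G] to [dom G], and
   [dom G] is infinite unless [G] is empty. *)
Let sqr_graph : set (set (K * K * K)) := [set G |
  [/\ forall t u, G t -> G u -> (t.1 = u.1 <-> t.2 = u.2),
      forall x y, dom G x -> dom G y -> exists z, G (x, y, z),
      forall x y z, G (x, y, z) -> dom G y /\ dom G z &
      G = set0 \/ infinite_set (dom G)]].

Let sqr_graph_bigcup (C : set (set (K * K * K))) :
  C `<=` sqr_graph -> total_on C subset -> sqr_graph (\bigcup_(G in C) G).
Proof.
move=> CP totC.
have both G H : C G -> C H -> exists2 L, C L & G `|` H `<=` L.
  move=> CG CH; have [GH|HG] := totC _ _ CG CH.
    by exists H => // t [/GH|].
  by exists G => // t [|/HG].
have domS G : C G -> dom G `<=` dom (\bigcup_(G in C) G).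
  by move=> CG x [y [z Gz]]; exists y, z, G.
split.
- move=> t u [G CG Gt] [H CH Hu]; have [L CL GHL] := both _ _ CG CH.
  have [inj _ _ _] := CP _ CL; apply: inj; apply: GHL; [by left|by right].
- move=> x y [x' [z [G CG Gz]]] [y' [z' [H CH Hz]]].
  have [L CL GHL] := both _ _ CG CH; have [_ tot _ _] := CP _ CL.
  have [||w Lw] := tot x y.
  + by exists x', z; apply: GHL; left.
  + by exists y', z'; apply: GHL; right.
  + by exists w, L.
- move=> x y z [G CG Gz]; have [_ _ st _] := CP _ CG.
  by have [dy dz] := st _ _ _ Gz; split; exact: (domS _ CG).
- have [[G CG Ginf]|/forall2NP nG] :=
      pselect (exists2 G, C G & infinite_set (dom G)).
    by right; exact: sub_infinite_set (domS _ CG) Ginf.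
  left; apply/seteqP; split=> // t [G CG Gt].
  have [_ _ _ [G0|Ginf]] := CP _ CG; first by rewrite G0 in Gt.
  by case: (nG G).
Qed.

(** Zorn gives a maximal [G]. If the complement of [dom G] is no larger than [dom G], then [K]
    embeds in [dom G], which is equivalent to its square. Otherwise the complement contains a copy
    of [dom G], and [G] extends to it, against maximality. *)
Lemma card_sqr_le : infinite_set [set: K] -> [set: K * K] #<= [set: K].
Proof.
move=> Kinf; have [G [GP Gmax]] := Zorn_bigcup sqr_graph_bigcup.
have [inj tot st dinf] := GP.
have {dinf}Sinf : infinite_set (dom G).
  (* An empty [G] is not maximal: a countable subset of [K] carries the pairing of [nat]. *)
  case: dinf => // G0; exfalso.
  have /type_card_leP[e eI] := (infiniteP _).1 Kinf.
  pose H : set (K * K * K) :=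
    [set t | exists i j, t = (e i, e j, e (pickle (i, j)))].
  have domH i : dom H (e i) by exists (e i), (e (pickle (i, i))), i, i.
  apply: (Gmax H).
    split; first by rewrite G0.
    by move=> /(_ (e 0, e 0, e (pickle (0, 0)))%N); rewrite G0; apply;
      exists 0%N, 0%N.
  split.
  - move=> _ _ [i [j ->]] [k [l ->]] /=; split=> [[/eI-> /eI->] //|].
    by move=> /eI/(pcan_inj pickleK)[-> ->].
  - move=> x y [x' [x'' [i [j [xi _ _]]]]] [y' [y'' [k [l [yk _ _]]]]].
    by rewrite xi yk; exists (e (pickle (i, k))), i, k.
  - by move=> x y z [i [j [_ -> ->]]].
  - right; apply/infiniteP/card_leTP; exists e => //.
pose S : Type := set_type (dom G).
have Sinf' : infinite_set [set: S].
  move=> Sfin; apply: Sinf; apply: card_le_finite Sfin.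
  by have [] := (card_eqPle _ _).1 (card_setT (dom G)).
have GS (x y : S) : exists z : S, G (val x, val y, val z).
  have [z Gz] := tot _ _ (set_mem (valP x)) (set_mem (valP y)).
  have [_ dz] := st _ _ _ Gz.
  by exists (SigSub (mem_set dz)).
have /choice[g gP] (u : S * S) : exists z : S, G (val u.1, val u.2, val z).
  exact: GS.
have gI : injective g.
  move=> u v guv; have := inj _ _ (gP u) (gP v); rewrite /= guv.
  case: u v {guv} => [a b] [c d] /= [_ /(_ erefl)[/val_inj-> /val_inj->]] //.
have SS : [set: S * S] #<= [set: S] by apply/type_card_leP; exists g.
have /type_card_leP[j jI] := card_sqr_bool Sinf' SS.
have [CS|SC] := card_le_total (~` dom G) (dom G).
  have /set_card_leP[h hI] := CS.
  have KS : [set: K] #<= [set: S].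
    apply/type_card_leP.
    pose k x : S := match pselect (dom G x) with
      | left dx => j (SigSub (mem_set dx), true)
      | right ndx => j (h (SigSub (mem_set (ndx : (~` dom G) x))), false) end.
    exists k => x y; rewrite /k.
    case: pselect => dx; case: pselect => dy /jI[] //.
    by move=> /hI[].
  apply: (card_le_trans _ (card_le_trans SS _)).
    have /type_card_leP[f fI] := KS; apply/type_card_leP.
    by exists (fun u => (f u.1, f u.2)) => -[a b] [c d] [/fI-> /fI->].
  by apply/type_card_leP; exists val; exact: val_inj.
have /set_card_leP[h hI] := SC; exfalso.
(* The tag [true] gives [dom G] itself, the tag [false] its copy in the complement. *)
pose r (u : S * bool) : K := if u.2 then val u.1 else val (h u.1).
have hS s : ~ dom G (val (h s)) by exact: set_mem (valP (h s)).
have rI : injective r.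
  move=> [s b] [s' c]; rewrite /r /=; case: b c => -[].
  - by move=> /val_inj->.
  - move=> ss; have := hS s'; rewrite -[X in dom G X]ss => -[].
    exact: set_mem (valP s).
  - move=> ss; have := hS s; rewrite [X in dom G X]ss => -[].
    exact: set_mem (valP s').
  - by move=> /val_inj/hI->.
(* The pairs with at least one new coordinate take their values in the new copy, so they do not
   collide with values of [G]. *)
pose H : set (K * K * K) := [set t | exists u v, ~~ (u.2 && v.2) /\
  t = (r u, r v, r (g (j u, j v), false))].
have Gr t : G t -> exists s s' s'',
    t = (r (s, true), r (s', true), r (s'', true)).
  case: t => -[x y] z Gt; have [dy dz] := st _ _ _ Gt.
  have dx : dom G x by exists y, z.
  by exists (SigSub (mem_set dx)), (SigSub (mem_set dy)), (SigSub (mem_set dz)).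
have [s0 _] := infinite_setN0 Sinf'.
have domGH u : dom (G `|` H) (r u).
  exists (r (s0, false)), (r (g (j u, j (s0, false)), false)); right.
  by exists u, (s0, false); rewrite andbF.
have domGHr x : dom (G `|` H) x -> exists u, x = r u.
  move=> [y [z [/Gr[s [_ [_ [-> _ _]]]]|[u [v [_ [-> _ _]]]]]]]; first by eexists.
  by exists u.
apply: (Gmax (G `|` H)).
  split; first exact: subsetUl.
  pose u := (s0, false).
  have Hu : H (r u, r u, r (g (j u, j u), false)) by exists u, u.
  by move=> /(_ _ (or_intror Hu))/Gr[s [s' [s'' [/rI]]]].
split.
- move=> t t' [Gt|Ht] [Gt'|Ht'].
  + exact: inj.
  + have [s [s' [s'' ->]]] := Gr _ Gt; have [u [v [uv ->]]] := Ht'.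
    split=> /= [[/rI uE /rI vE]|/rI//].
    by rewrite -uE -vE in uv.
  + have [s [s' [s'' ->]]] := Gr _ Gt'; have [u [v [uv ->]]] := Ht.
    split=> /= [[/rI uE /rI vE]|/rI//].
    by rewrite uE vE in uv.
  + have [u [v [uv ->]]] := Ht; have [u' [v' [_ ->]]] := Ht'.
    split=> /= [[/rI-> /rI->] //|/rI[/gI[/jI-> /jI->]]] //.
- move=> x y /domGHr[[s b] ->] /domGHr[[s' b'] ->].
  have [/andP[/= -> ->]|bb'] := boolP (b && b').
    by have [z Gz] := GS s s'; exists (val z); left.
  by eexists; right; exists (s, b), (s', b').
- move=> x y z [/Gr[s [s1 [s2 [_ -> ->]]]]|[u [v [_ [_ -> ->]]]]].
    by split; exact: domGH.
  by split; exact: domGH.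
- right; apply: sub_infinite_set Sinf => x [y [z Gz]].
  by exists y, z; left.
Qed.

End square.

Lemma card_mul_le (K L M : Type) : infinite_set [set: M] ->
  [set: K] #<= [set: M] -> [set: L] #<= [set: M] -> [set: K * L] #<= [set: M].
Proof.
move=> Minf /type_card_leP[f fI] /type_card_leP[g gI].
apply: card_le_trans (card_sqr_le Minf); apply/type_card_leP.
by exists (fun u => (f u.1, g u.2)) => -[a b] [c d] [/fI-> /gI->].
Qed.

Lemma card_ltNge T U (A : set T) (B : set U) : A #< B <-> ~ (B #<= A).
Proof.
split=> [[]//|nBA]; split=> //.
by have [] := card_le_total A B.
Qed.

Lemma card_le_lt_trans T U V (B : set U) (A : set T) (C : set V) :
  A #<= B -> B #< C -> A #< C.
Proof.
move=> AB /card_ltNge nCB; apply/card_ltNge => CA.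
by apply: nCB; exact: card_le_trans CA AB.
Qed.

Lemma card_setU_le (M T : Type) (A B : set T) : infinite_set [set: M] ->
  A #<= [set: M] -> B #<= [set: M] -> A `|` B #<= [set: M].
Proof.
move=> Minf AM BM.
apply: card_le_trans (card_sqr_bool Minf (card_sqr_le Minf)).
have /type_card_leP[f fI] : [set: set_type A] #<= [set: M].
  by apply: card_le_trans AM; have [] := (card_eqPle _ _).1 (card_setT A).
have /type_card_leP[g gI] : [set: set_type B] #<= [set: M].
  by apply: card_le_trans BM; have [] := (card_eqPle _ _).1 (card_setT B).
have /choice[h hP] (x : set_type (A `|` B)) : exists u : M * bool,
    if u.2 then exists2 a, val a = val x & f a = u.1
    else exists2 b, val b = val x & g b = u.1.
  have [Ax|Bx] := set_mem (valP x).
    by exists (f (SigSub (mem_set Ax)), true); exists (SigSub (mem_set Ax)).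
  by exists (g (SigSub (mem_set Bx)), false); exists (SigSub (mem_set Bx)).
have hI : injective h.
  move=> x y xy; have := hP x; have := hP y; rewrite xy => hy hx.
  suff /val_inj : val x = val y by []; move: hy hx.
  by case: ifP => _ [a ay <-] [b bx] => [/fI|/gI] ba; rewrite -ay -bx ba.
apply: (card_le_trans (B := [set: set_type (A `|` B)])).
  by have [] := (card_eqPle _ _).1 (card_setT (A `|` B)).
by apply/type_card_leP; exists h.
Qed.

(** The larger set absorbs the smaller one if it is infinite; if it is finite, so is the union. *)
Lemma card_setU_lt (K T : Type) (A B : set T) : infinite_set [set: K] ->
  A #< [set: K] -> B #< [set: K] -> A `|` B #< [set: K].
Proof.
move=> Kinf AK BK; wlog AB : A B AK BK / A #<= B.
  move=> H; have [AB|BA] := card_le_total A B; first exact: H.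
  by rewrite setUC; exact: H.
have [Bfin|Binf] := pselect (finite_set B).
  apply/card_ltNge => /card_le_finite KAB; apply: Kinf; apply: KAB.
  by rewrite finite_setU; split=> //; exact: card_le_finite AB Bfin.
have [BB BB'] := (card_eqPle _ _).1 (card_setT B).
apply: card_le_lt_trans BK; apply: card_le_trans BB.
apply: card_setU_le => //; last exact: card_le_trans AB BB'.
by move=> /(card_le_finite BB').
Qed.

(** Only finitely many fibers are united for each [n]; the union of all of them is [K]. *)
Lemma card_countable_union_lt (K : Type) (rho : K -> nat) (n : nat) :
  infinite_set [set: K] -> (forall n, [set x | rho x = n] #< [set: K]) ->
  [set x | (rho x <= n)%N] #< [set: K].
Proof.
move=> Kinf fib; elim: n => [|n IHn].
  by have := fib 0%N; congr (_ #< _); apply/seteqP; split=> x /=; lia.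
have := card_setU_lt Kinf IHn (fib n.+1); congr (_ #< _).
by apply/seteqP; split=> x /=; lia.
Qed.

(** * Cofinality, finite and countable cofinal sets *)

Lemma cofinality_le (K : cardinal) : [set: cofinality K] #<= [set: K].
Proof.
have [_] := cofinalityP K; apply.
have [R Rini] := initial_well_order_ex K; exists R; split=> //.
by exists setT => // x; exists x => //; exact: well_order_refl Rini.1 x.
Qed.

(** A finite cofinal set would make [K] a finite union of initial segments, all smaller than [K]. *)
Lemma cofinality_infinite (K : cardinal) :
  infinite_set [set: K] -> [set: nat] #<= [set: cofinality K].
Proof.
move=> Kinf; apply/infiniteP => cfin.
have [[R [[Rwo seg] [C Ccof KC]]] _] := cofinalityP K.
have /finite_setP[n /card_eqPle[/set_card_leP[f fI] _]] : finite_set C.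
  by apply: card_le_finite cfin; have [] := (card_eqPle _ _).1 KC.
have /choice[y yP] x : exists y : C, R x (val y).
  by have [y Cy xy] := Ccof x; exists (SigSub (mem_set Cy)).
have seg1 z : [set x | R x z] #< [set: K].
  apply: card_le_lt_trans (card_setU_lt Kinf (seg z) (_ : [set z] #< _)).
    apply: subset_card_le => x /= xz.
    by have [->|xz'] := pselect (x = z); [right|left].
  apply/card_ltNge => /card_le_finite K1; apply: Kinf; apply: K1.
  exact: finite_set1.
(* Color [x] by the number of its chosen bound [y x]; each fiber lies below a single bound. *)
have /(card_countable_union_lt n Kinf) : forall m,
    [set x | val (f (y x)) = m] #< [set: K].
  move=> m; have [[x xm]|nm] := pselect (exists x, val (f (y x)) = m).
    apply: card_le_lt_trans (seg1 (val (y x))); apply: subset_card_le => z /= zm.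
    suff -> : y x = y z by exact: yP.
    by apply: fI; apply: val_inj; exact: etrans xm (esym zm).
  apply/card_ltNge => /card_le_finite K0; apply: Kinf; apply: K0.
  suff -> : [set x | val (f (y x)) = m] = set0 by exact: finite_set0.
  by apply/seteqP; split=> // x xm; case: nm; exists x.
move=> /card_ltNge; apply; apply: subset_card_le => x _ /=.
exact: ltnW (set_mem (valP (f (y x)))).
Qed.

(** Order [K] first by [rho] and then by a well-order [W]. An initial segment meets only finitely
    many fibers, so the order is initial, and any sequence with unbounded [rho] is cofinal. *)
Lemma cofinality_le_nat (K : cardinal) (rho : K -> nat) :
  infinite_set [set: K] -> (forall n, [set x | rho x = n] #< [set: K]) ->
  [set: cofinality K] #<= [set: nat].
Proof.
move=> Kinf fib.
have [W [Wwo _]] := initial_well_order_ex K.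
have /well_order_setP wo := Wwo.
have /choice[c cP] n : exists x, (n < rho x)%N.
  apply: contrapT => /forallNP nx.
  have /card_ltNge := card_countable_union_lt n Kinf fib; apply.
  by apply: subset_card_le => x _ /=; rewrite leqNgt; apply/negP/nx.
have [_ minK] := cofinalityP K.
pose R : rel K := fun x y => (rho x < rho y)%N || (rho x == rho y) && W x y.
apply: card_le_trans (minK (set_type (range c)) _) _; last first.
  apply: card_le_trans (card_image_le c setT).
  by have [] := (card_eqPle _ _).1 (card_setT (range c)).
exists R; split; last first.
  exists (range c); last exact: card_setT.
  move=> x; exists (c (rho x)); first by exists (rho x).
  by rewrite /R cP.
split.
  apply/well_order_setP => A [a Aa].
  pose N n := `[< exists2 x, A x & rho x = n >].
  have exN : exists n, N n by exists (rho a); apply/asboolP; exists a.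
  case: (ex_minnP exN) => n /asboolP[b Ab bn] nmin.
  have nle x : A x -> (n <= rho x)%N.
    by move=> Ax; apply: nmin; apply/asboolP; exists x.
  have [|z [[Az zn] minz uz]] := wo [set x | A x /\ rho x = n].
    by exists b.
  exists z; split=> //.
    move=> y Ay; rewrite /R zn; have := nle _ Ay.
    by case: ltngtP => //= yn _; apply: minz.
  move=> t At mint; apply: uz.
    split=> //; apply/eqP; rewrite eqn_leq nle // andbT.
    by have := mint _ Az; rewrite /R zn; lia.
  move=> y [Ay yn]; have := mint _ Ay; rewrite /R yn.
  by have := nle _ At; case: ltngtP.
move=> x; apply: card_le_lt_trans (card_countable_union_lt (rho x) Kinf fib).
by apply: subset_card_le => y [] /=; rewrite /R; lia.
Qed.

(** * Successor cardinals and their regularity *)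

Lemma card_lt_succ (K : cardinal) : [set: K] #< [set: card_succ K].
Proof. by have [] := card_succP K. Qed.

Lemma card_lt_set (K : Type) : [set: K] #< [set: set K].
Proof.
apply/card_ltNge => /type_card_leP[f fI].
pose D : set K := [set x | exists2 S, f S = x & ~ S x].
have nD : ~ D (f D) by move=> /[dup] DD [S /fI ->].
by apply: (nD); exists D.
Qed.

Lemma card_succ_le (K L : cardinal) :
  [set: K] #< [set: L] -> [set: card_succ K] #<= [set: L].
Proof. by have [_] := card_succP K; apply. Qed.

Lemma infinite_card_succ (K : cardinal) :
  infinite_set [set: K] -> infinite_set [set: card_succ K].
Proof. by move=> Kinf; apply: infinite_card_le Kinf _; have [] := card_lt_succ K. Qed.

(** If all fibers had size at most [K], then the color together with the position inside the fiber
    would inject [K^+] into [K * K]. *)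
Lemma card_succ_fiber (K : cardinal) (f : card_succ K -> K) :
  infinite_set [set: K] ->
  exists c, [set x | f x = c] #= [set: card_succ K].
Proof.
move=> Kinf; apply: contrapT => /forallNP nf.
have fibK c : [set: set_type [set x | f x = c]] #<= [set: K].
  have [//|Kfib] := card_le_total [set: set_type [set x | f x = c]] [set: K].
  apply: contrapT => /card_ltNge/card_succ_le sfib; apply: (nf c).
  apply/card_eqPle; split; first exact: card_leT.
  apply: card_le_trans sfib _.
  by have [] := (card_eqPle _ _).1 (card_setT [set x | f x = c]).
have [k0 _] := infinite_setN0 Kinf.
have /choice[h hI] c : exists h : card_succ K -> K,
    forall x y, f x = c -> f y = c -> h x = h y -> x = y.
  have /type_card_leP[g gI] := fibK c.
  exists (fun x => if pselect (f x = c) is left xc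
                   then g (SigSub (mem_set (xc : [set x | f x = c] x))) else k0).
  by move=> x y xc yc; case: pselect => // ?; case: pselect => // ? /gI/(congr1 val).
have /card_ltNge := card_lt_succ K; apply.
apply: card_le_trans (card_sqr_le Kinf); apply/type_card_leP.
exists (fun x => (f x, h (f x) x)) => x y [fxy]; rewrite fxy => hxy.
exact: hI hxy.
Qed.

(** * Super calibers through networks and discrete families *)

Lemma open_CL_vietoris (X : topologicalType) (W : set (CL X)) (A : CL X) :
  open W -> W A -> exists (n : nat) (U : 'I_n.+1 -> set X),
    [/\ forall i, open (U i), vietoris U A & vietoris U `<=` W].
Proof.
move=> [D DB <-] [V DV VA]; have [n [U [oU VU]]] := DB _ DV.
exists n, U; split; rewrite -?VU // => B VB; by exists V.
Qed.

Lemma open_vietoris (X : topologicalType) (n : nat) (U : 'I_n.+1 -> set X) :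
  (forall i, open (U i)) -> open (vietoris U).
Proof.
move=> oU; exists [set vietoris U]; last by rewrite bigcup_set1.
by move=> _ ->; exists n, U.
Qed.

(** Color [k] by a network member that contains [x k] and lies in [U k]; any fiber satisfies the
    mutual membership condition. *)
Lemma super_caliber_network (X : topologicalType) (C K : Type) (N : C -> set X) :
  (forall x U, open U -> U x -> exists2 c, N c x & N c `<=` U) ->
  (forall f : K -> C, exists c, [set k | f k = c] #= [set: K]) ->
  super_caliber X K.
Proof.
move=> netN fib x U oU Ux.
have /choice[f fP] k : exists c, N c (x k) /\ N c `<=` U k.
  by have [c] := netN _ _ (oU k) (Ux k); exists c.
have [c fc] := fib f; exists [set k | f k = c]; split=> // a b /= fa fb.
by apply: (fP b).2; rewrite fb -fa; exact: (fP a).1.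
Qed.

(** Apply the super caliber to the points [p (f k)] and the sets [V (f k)]: [f] is constant on the
    resulting [J]. *)
Lemma super_caliber_fiber (X : topologicalType) (C K : Type) (p : C -> X)
    (V : C -> set X) :
  (forall c, open (V c)) -> (forall c c', V c (p c') <-> c = c') ->
  infinite_set [set: K] -> super_caliber X K ->
  forall f : K -> C, exists c, [set k | f k = c] #= [set: K].
Proof.
move=> oV Vp Kinf sc f.
have [||J [JK JV]] := sc (p \o f) (V \o f); first by move=> a; exact: oV.
  by move=> a; apply/Vp.
have /card_eqPle[_ KJ] := JK.
have [a Ja] : J !=set0.
  apply: infinite_setN0 => Jfin; apply: Kinf; exact: card_le_finite KJ Jfin.
exists (f a); apply/card_eqPle; split; first exact: card_leT.
apply: card_le_trans KJ _; apply: subset_card_le => b Jb /=.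
by apply/Vp; exact: JV.
Qed.

Lemma weight_network (X : topologicalType) (C : Type) :
  [set: weight X] #<= [set: C] -> exists2 N : C -> set X,
    forall c, open (N c) &
    forall x U, open U -> U x -> exists2 c, N c x & N c `<=` U.
Proof.
move=> wC; have [[B [oB xB] /card_eqPle[_ wB]] _] := weightP X.
have /type_card_leP[f fI] : [set: set_type B] #<= [set: C].
  apply: card_le_trans wC; apply: card_le_trans wB.
  by have /card_eqPle[] := card_setT B.
(* As [f] is injective, this is the basic set coded by [c], or empty if [c] codes none. *)
exists (fun c => \bigcup_(V in [set V | f V = c]) val V).
  by move=> c; apply: bigcup_open => V _; apply: oB; exact: set_mem (valP V).
move=> x U oU Ux; have [|V [BV Vx] VU] := xB x U; first exact: open_nbhs_nbhs.
exists (f (SigSub (mem_set BV))); first by exists (SigSub (mem_set BV)).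
by move=> y [W /= /fI->] /VU.
Qed.

Lemma weight_le (X : topologicalType) (L : cardinal) (B : set (set X)) :
  basis B -> B #<= [set: L] -> [set: weight X] #<= [set: L].
Proof.
move=> basB; apply: card_le_trans; have [_ minw] := weightP X.
apply: card_le_trans (minw (set_type B) _) _.
  by exists B => //; exact: card_setT.
by have /card_eqPle[] := card_setT B.
Qed.

Lemma SC_card_succ_weight (X : topologicalType) :
  infinite_set [set: weight X] -> SC X (card_succ (weight X)).
Proof.
move=> winf; split; first exact: infinite_card_succ.
have [N _ netN] := weight_network (card_lexx [set: weight X]).
apply: super_caliber_network netN _ => f; exact: card_succ_fiber.
Qed.

(** Singletons embed [X] in [CL X], and the trace of [<V>] on them is [V]. *)
Lemma SC_CL (X : topologicalType) (K : cardinal) :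
  (forall x : X, closed [set x]) -> SC (CL X) K -> SC X K.
Proof.
move=> cl1 [Kinf sc]; split=> // x U oU Ux.
pose s (y : X) : CL X := MkCL (cl1 y) (ex_intro _ y erefl).
have sV y V : vietoris (fun _ : 'I_1 => V) (s y) <-> V y.
  split=> [[yV _]|Vy]; first by have [] := yV y erefl.
  by split=> [z ->|i]; [exists ord0|exists y].
have [||J [JK JU]] := sc (s \o x) (fun k => vietoris (fun _ : 'I_1 => U k)).
- by move=> a; exact: open_vietoris.
- by move=> a; apply/sV.
- by exists J; split=> // a b Ja Jb; apply/sV; exact: JU.
Qed.

(** Membership of [A a] in [<U b>] encodes the inclusion of [g' a] in [g' b]. On [J] all these
    inclusions hold, so [g'] is constant on an infinite set, although it is almost injective. *)
Lemma not_super_caliber_CL (X : topologicalType) (I K : Type) (p : I -> X) :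
  injective p -> (forall S : set I, closed (p @` S)) ->
  infinite_set [set: I] -> infinite_set [set: K] -> [set: K] #<= [set: set I] ->
  ~ super_caliber (CL X) K.
Proof.
move=> pI clp Iinf Kinf /type_card_leP[g gI] sc.
have [i0 _] := infinite_setN0 Iinf.
(* The empty set is not a point of [CL X]; replacing it by [setT] keeps the
   map [g] at most two-to-one. *)
pose g' k := if pselect (g k !=set0) then g k else setT.
have g'0 k : p @` g' k !=set0.
  rewrite /g'; case: pselect => [[i gi]|?]; first by exists (p i), i.
  by exists (p i0), i0.
pose A k : CL X := MkCL (clp (g' k)) (g'0 k).
pose U k : set X := ~` (p @` (~` g' k)).
have AU a b : vietoris (fun _ : 'I_1 => U b) (A a) <-> g' a `<=` g' b.
  split=> [[AU _] i ai|ab].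
    have [|_ _ Ui] := AU (p i); first by exists i.
    by apply: contrapT => bi; apply: Ui; exists i.
  have AU : p @` g' a `<=` U b.
    by move=> _ [i ai <-] [j nbj /pI ji]; apply: nbj; rewrite ji; exact: ab.
  split=> [x Ax|_]; first by exists ord0 => //; exact: AU.
  by have [x Ax] := g'0 a; exists x; split=> //; exact: AU.
have [||J [JK JU]] := sc A (fun k => vietoris (fun _ : 'I_1 => U k)).
- by move=> a; apply: open_vietoris => _; exact: closed_openC.
- by move=> a; apply/AU.
have /card_eqPle[_ KJ] := JK.
have /card_leTP[h hI hJ] : [set: nat] #<= J.
  by apply: card_le_trans KJ; exact/infiniteP.
have g'J a b : J a -> J b -> g' a = g' b.
  by move=> Ja Jb; apply/seteqP; split; apply/AU; exact: JU.
have inj n m : g (h n) !=set0 -> g (h m) !=set0 -> n = m.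
  move=> gn gm; apply/hI/gI; have := g'J _ _ (hJ n) (hJ m).
  by rewrite /g'; case: pselect => // ?; case: pselect.
have inj0 n m : ~ (g (h n) !=set0) -> ~ (g (h m) !=set0) -> n = m.
  move=> /set0P/negP/negPn/eqP gn /set0P/negP/negPn/eqP gm.
  by apply/hI/gI; rewrite gn gm.
(* Among three elements of [J], two have both values of [g] empty or both nonempty, and such
   elements coincide. *)
have [g0|g0] := pselect (g (h 0%N) !=set0);
  have [g1|g1] := pselect (g (h 1%N) !=set0);
  have [g2|g2] := pselect (g (h 2%N) !=set0).
all: by [have := inj _ _ g0 g1|have := inj _ _ g0 g2|have := inj _ _ g1 g2|
         have := inj0 _ _ g0 g1|have := inj0 _ _ g0 g2|have := inj0 _ _ g1 g2].
Qed.

(** * Separated sets in metric spaces and the weight *)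

Section metric.
Variables (R : realType) (X : topologicalType) (d : X -> X -> R).
Hypotheses (dm : is_metric d) (dX : induces_topology d).

Let d_refl x : d x x = 0.
Proof. by have [_ d0 _ _] := dm; apply/d0. Qed.

Let d_gt0 x y : x <> y -> 0 < d x y.
Proof.
by have [dge0 d0 _ _] := dm => xy; rewrite lt0r dge0 andbT; apply/eqP => /d0.
Qed.

Let d_sym x y : d x y = d y x.
Proof. by have [_ _ + _] := dm; apply. Qed.

Let d_tri x y z : d x z <= d x y + d y z.
Proof. by have [_ _ _] := dm; apply. Qed.

Lemma open_metric_ball x e : open [set y | d x y < e].
Proof.
apply/dX => y /= xy; exists (e - d x y); first by rewrite subr_gt0.
by move=> z /=; have := d_tri x y z; lra.
Qed.

Lemma metric_basisP x (U : set X) : open U -> U x ->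
  exists n, [set y | d x y < n.+1%:R^-1] `<=` U.
Proof.
move=> /dX oU /oU[e e0 eU].
exists (Num.bound e^-1) => y /= xy; apply: eU => /=; apply: lt_le_trans xy _.
have e1 : 0 < e^-1 by rewrite invr_gt0.
rewrite invf_ple ?posrE ?ltr0n //.
apply: le_trans (ltW (archi_boundP (ltW e1))) _.
by rewrite ler_nat.
Qed.

Definition separated_by (e : R) (D : set X) :=
  forall x y, D x -> D y -> x <> y -> e <= d x y.

(** A ball of radius [e / 2] contains at most one point of [D]. *)
Lemma separated_closed (e : R) (D : set X) :
  0 < e -> separated_by e D -> closed D.
Proof.
move=> e0 sepD; rewrite -openC; apply/dX => x nDx.
have [[y [Dy xy]]|ny] := pselect (exists y, D y /\ d x y < e / 2).
  have yx : x <> y by move=> yx; rewrite yx in nDx.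
  exists (d x y); first exact: d_gt0.
  move=> z /= xz Dz.
  have [zy|zy] := pselect (z = y); first by rewrite zy ltxx in xz.
  have := sepD z y Dz Dy zy; have := d_tri z x y; rewrite (d_sym z x); lra.
exists (e / 2); first by lra.
by move=> y /= xy Dy; apply: ny; exists y.
Qed.

Lemma separated_sub e (D S : set X) :
  S `<=` D -> separated_by e D -> separated_by e S.
Proof. by move=> SD sep x y /SD Dx /SD Dy; exact: sep. Qed.

Lemma metric_closed1 (x : X) : closed [set x].
Proof. by apply: (@separated_closed 1) => // y z -> ->. Qed.

Lemma maximal_separated e : 0 < e ->
  exists2 D, separated_by e D & forall x, exists2 y, D y & d x y < e.
Proof.
move=> e0; have [C CP totC|D [sepD Dmax]] := @Zorn_bigcup _ [set D | separated_by e D].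
  move=> x y [A CA Ax] [B CB By].
  have [AB|BA] := totC _ _ CA CB; first by apply: (CP _ CB) => //; exact: AB.
  by apply: (CP _ CA) => //; exact: BA.
exists D => // x; apply: contrapT => /forall2NP nx.
have far y : D y -> e <= d x y.
  by move=> Dy; have [//|/negP] := nx y; rewrite -leNgt.
apply: (Dmax (D `|` [set x])).
  split; first exact: subsetUl.
  by move=> /(_ x (or_intror erefl)) /far; rewrite d_refl; lra.
move=> y z [Dy|->] [Dz|->] //; first exact: sepD.
- by move=> _; rewrite d_sym; exact: far.
- by move=> _; exact: far.
Qed.

(** For maximal [D n], the balls of radius [1/(n+1)] around the points of [D n], over all [n], form
    a base. *)
Lemma separated_weight : exists D : nat -> set X,
  (forall n, separated_by n.+1%:R^-1 (D n)) /\
  [set: weight X] #<= [set: {n : nat & D n}].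
Proof.
have /choice[D DP] n : exists D, separated_by n.+1%:R^-1 D /\
    forall x, exists2 y, D y & d x y < n.+1%:R^-1.
  have [|D] := @maximal_separated n.+1%:R^-1; last by exists D.
  by rewrite invr_gt0 ltr0n.
exists D; split=> [n|]; first by have [] := DP n.
pose b (u : {n : nat & D n}) : set X :=
  [set y | d (val (projT2 u)) y < (projT1 u).+1%:R^-1].
apply: (@weight_le _ _ (range b)); last exact: card_image_le.
split=> [_ [u _ <-]|x U]; first exact: open_metric_ball.
rewrite nbhsE => -[V [oV Vx] VU].
have [n nV] := metric_basisP oV Vx.
(* This index gives the radius [1/(2n+2)], half of [1/(n+1)]. *)
have [y Dy xy] := (DP (n.*2.+1)).2 x.
exists (b (existT _ (n.*2.+1) (SigSub (mem_set Dy)))).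
  by split; [eexists|rewrite /b /= d_sym].
move=> z /= yz; apply/VU/nV => /=; apply: le_lt_trans (d_tri x y z) _.
have -> : n.+1%:R^-1 = n.*2.+2%:R^-1 + n.*2.+2%:R^-1 :> R.
  rewrite -doubleS -muln2 natrM; field.
  by rewrite nat1r pnatr_eq0.
exact: ltrD.
Qed.

Lemma separated_not_super_caliber_CL (e : R) (D : set X) (I : Type) :
  0 < e -> separated_by e D -> infinite_set [set: weight X] ->
  [set: weight X] #< [set: set I] ->
  infinite_set [set: I] -> [set: I] #<= D ->
  ~ SC (CL X) (card_succ (weight X)).
Proof.
move=> e0 sepD winf wI Iinf /card_leTP[p pI pD] [_].
apply: (not_super_caliber_CL pI) => //.
- move=> S; apply: (separated_closed e0); apply: separated_sub sepD => _ [i _ <-].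
  exact: pD.
- exact: infinite_card_succ.
- exact: card_succ_le.
Qed.

(** If every [D n] were smaller than [w(X)], the injection [j] would split [w(X)] into countably
    many smaller fibers and its cofinality would be countable. *)
Lemma not_SC_cofinality_gt :
  [set: nat] #< [set: cofinality (weight X)] ->
  ~ SC (CL X) (card_succ (weight X)).
Proof.
move=> cofw; have winf : infinite_set [set: weight X].
  apply/infiniteP; apply: card_le_trans (cofinality_le _); by case: cofw.
have [D [sepD /type_card_leP[j jI]]] := separated_weight.
have [[n wD]|nD] := pselect (exists n, [set: weight X] #<= D n).
  apply: (separated_not_super_caliber_CL _ (sepD n)) wD => //.
    by rewrite invr_gt0 ltr0n.
  exact: card_lt_set.
have /card_ltNge[] := cofw; apply: (@cofinality_le_nat _ (fun x => projT1 (j x))) => //.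
move=> n; apply/card_ltNge => wn; apply: nD; exists n; apply: card_le_trans wn _.
apply/set_card_leP.
have /choice[h hP] (x : set_type [set x | projT1 (j x) = n]) :
    exists y : D n, j (val x) = existT _ n y.
  by case: x => x /= /set_mem/= <-; exists (projT2 (j x)); case: (j x).
exists h => x y xy; apply/val_inj/jI; by rewrite !hP xy.
Qed.

(** If every [D n] were finite, their disjoint union would be countable, and so would [w(X)]. An
    infinite [D n] yields [2^omega] closed sets, more than [w(X)]. *)
Lemma not_SC_weight_lt_continuum :
  [set: nat] #< [set: weight X] -> [set: weight X] #< [set: set nat] ->
  ~ SC (CL X) (card_succ (weight X)).
Proof.
move=> natw wc; have winf : infinite_set [set: weight X].
  by apply/infiniteP; case: natw.
have [D [sepD wD]] := separated_weight.
have [[n Dn]|nD] := pselect (exists n, infinite_set (D n)).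
  apply: (separated_not_super_caliber_CL _ (sepD n)) wc _ _ => //.
  - by rewrite invr_gt0 ltr0n.
  - exact: infinite_nat.
  - exact/infiniteP.
exfalso; have /card_ltNge := natw; apply; apply: card_le_trans wD _.
have /choice[h hI] n : exists h : X -> nat, {in D n &, injective h}.
  have : countable (D n).
    apply: finite_set_countable; apply: contrapT => Dn.
    by apply: nD; exists n.
  by move=> /countable_injP.
apply: (card_le_trans (B := [set: nat * nat])); last first.
  by have /card_eqPle[] := card_nat2.
apply/type_card_leP; exists (fun u : {n : nat & D n} =>
  (projT1 u, h (projT1 u) (val (projT2 u)))).
move=> [n x] [m y] /= [nm]; move: y; rewrite -nm => y xy.
congr existT; apply/val_inj/(hI n) => //; exact: valP.
Qed.

End metric.

(** * Countable weight: compactness and its failure *)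

(* The library states [compact_cover] for pointed spaces only. *)
Lemma compact_cover_point (X : topologicalType) (x0 : X) :
  @compact X = @cover_compact X.
Proof.
pose p : isPointed X := isPointed.Build X x0.
pose X' : ptopologicalType := HB.pack_for ptopologicalType X p.
exact: (@compact_cover X').
Qed.

(** A list [s] stands for the Vietoris set given by the [N c] with [c] in [s]; compactness of [A]
    makes finite lists suffice. *)
Lemma compact_CL_network (X : topologicalType) (C : countType) (N : C -> set X) :
  compact [set: X] -> (forall c, open (N c)) ->
  (forall x U, open U -> U x -> exists2 c, N c x & N c `<=` U) ->
  exists M : seq C -> set (CL X),
    forall A W, open W -> W A -> exists2 s, M s A & M s `<=` W.
Proof.
move=> cX oN netN.
exists (fun s => [set A : CL X | CL_set A `<=` \bigcup_(c in [set` s]) N c /\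
  forall c, c \in s -> CL_set A `&` N c !=set0]).
move=> A W oW WA; have [n [U [oU [AU AUi] UW]]] := open_CL_vietoris oW WA.
have [x0 _] := CL_neq0 A.
have := subclosed_compact (CL_closed (c := A)) cX (@subsetT _ _).
rewrite (compact_cover_point x0).
pose D : set C := [set c | CL_set A `&` N c !=set0 /\ exists i, N c `<=` U i].
move=> /(_ C D N (fun c _ => oN c))[x Ax|D' D'D AD'].
  have [i _ Uix] := AU x Ax; have [c cx cU] := netN _ _ (oU i) Uix.
  by exists c => //; split; [exists x|exists i].
have /choice[c cP] i : exists c, N c `<=` U i /\ CL_set A `&` N c !=set0.
  have [x [Ax Ux]] := AUi i; have [c cx cU] := netN _ _ (oU i) Ux.
  by exists c; split=> //; exists x.
(* The subcover [D'] keeps [B] inside the union of the [U i]; the added [c i] make [B] meet each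
   [U i]. *)
exists (finmap.enum_fset D' ++ [seq c i | i <- enum 'I_n.+1]).
  split=> [x /AD'[k kD' kx]|k].
    by exists k => //=; rewrite mem_cat; apply/orP; left.
  rewrite mem_cat => /orP[/D'D/set_mem[]//|/mapP[i _ ->]].
  exact: (cP i).2.
move=> B [BN BNc]; apply: UW; split=> [x /BN[k]|i].
  rewrite /= mem_cat => /orP[/D'D/set_mem[_ [i kU]] kx|/mapP[i _ ->] cx].
    by exists i => //; exact: kU.
  by exists i => //; exact: (cP i).1.
have [|x [Bx cx]] := BNc (c i).
  by rewrite mem_cat; apply/orP; right; apply/mapP; exists i; rewrite ?mem_enum.
by exists x; split=> //; exact: (cP i).1.
Qed.

(* A point outside the first [n] members of a countable cover without finite
   subcover, for each [n], gives a locally finite sequence. *)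
Lemma not_compact_closed_sequence (X : topologicalType) (C : countType)
    (N : C -> set X) :
  (forall x : X, closed [set x]) -> (forall c, open (N c)) ->
  (forall x U, open U -> U x -> exists2 c, N c x & N c `<=` U) ->
  ~ compact [set: X] -> exists2 p : nat -> X, injective p &
    forall S : set nat, closed (p @` S).
Proof.
move=> cl1 oN netN ncX.
have [x0 _] : [set: X] !=set0.
  by apply/set0P/negP => /eqP X0; apply: ncX; rewrite X0; exact: compact0.
move: ncX; rewrite (compact_cover_point x0).
move=> /existsNP[J /existsNP[D /existsNP[f /not_implyP[of' /not_implyP[Df nfin]]]]].
(* These basic sets form a countable refinement of the given cover. *)
pose good : set C := [set c | exists2 i, D i & N c `<=` f i].
have goodP x : exists2 c, good c & N c x.
  have [//|i Di fx] := Df x; have [c cx cf] := netN _ _ (of' i Di) fx.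
  by exists c => //; exists i.
have [i0 _ _] := Df x0 I.
have /choice[h hP] c : exists i, good c -> D i /\ N c `<=` f i.
  have [[i Di ci]|nc] := pselect (good c); first by exists i.
  by exists i0.
have /choice[x xP] n : exists x, forall c, good c -> (pickle c < n)%N -> ~ N c x.
  apply: contrapT => /forallNP nx; apply: nfin.
  pose A := h @` [set c | good c /\ (pickle c < n)%N].
  have Afin : finite_set A.
    apply: finite_image.
    apply: sub_finite_set (finite_seq (pmap unpickle (iota 0 n))).
    move=> c [_ cn] /=; rewrite mem_pmap; apply/mapP.
    by exists (pickle c); rewrite ?mem_iota ?pickleK.
  exists (fset_set A) => [i|y _].
    by rewrite in_fset_set // => /set_mem[c [gc _] <-]; apply/mem_set; case: (hP c gc).
  have /existsNP[c /not_implyP[gc /not_implyP[cn /contrapT Ncy]]] := nx y.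
  exists (h c); last exact: (hP c gc).2.
  by rewrite /= in_fset_set //; apply/mem_set; exists c.
have loc c : good c -> finite_set [set n | N c (x n)].
  move=> gc; apply: sub_finite_set (finite_II (pickle c).+1) => n /= Ncx.
  by rewrite ltnS leqNgt; apply/negP => /(xP n c gc).
(* Each value lies in a good set and is therefore taken only finitely often. *)
have xinf : infinite_set (range x).
  move=> xfin; apply: infinite_nat.
  apply: (@sub_finite_set _ _ (\bigcup_(y in range x) [set n | x n = y])).
    by move=> n _; exists (x n); [exists n|].
  apply: bigcup_finite => // y _; have [c gc cy] := goodP y.
  by apply: sub_finite_set (loc c gc) => n /= ->.
have /card_leTP[p pI px] := (infiniteP _).1 xinf.
exists p => // S; rewrite -openC openE => y ny.
(* [T] is finite, hence closed, and removing it from [N c] leaves a neighborhood of [y]. *)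
have [c gc cy] := goodP y; pose T := p @` S `&` N c.
have cT : closed T.
  rewrite (_ : T = \bigcup_(t in T) [set t]); last first.
    by apply/seteqP; split=> [t Tt|t [_ Tt ->]] //; exists t.
  apply: closed_bigcup => //.
  apply: (@sub_finite_set _ _ (x @` [set n | N c (x n)])); last exact/finite_image/loc.
  move=> _ [[k _ <-]]; have [n _ <-] := px k => Nx.
  by exists n.
apply: (@filterS _ _ _ (N c `&` ~` T)).
  by move=> z [Nz nTz] Sz; apply: nTz.
by apply: open_nbhs_nbhs; split; [apply: openI => //; exact: closed_openC|split=> // -[]].
Qed.

(** Near a non-isolated point [x], take points whose distances to [x] more than halve at each step,
    and separate them by annuli around [x]. If all points are isolated, any injective sequence
    works. *)
Lemma infinite_metric_discrete_sequence (R : realType) (X : topologicalType)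
    (d : X -> X -> R) : is_metric d -> induces_topology d ->
  infinite_set [set: X] -> exists (p : nat -> X) (V : nat -> set X),
    (forall n, open (V n)) /\ forall n m, V n (p m) <-> n = m.
Proof.
move=> dm dX Xinf; have [dge0 d0 dsym dtri] := dm.
have [[x xP]|iso] := pselect (exists x, forall e, 0 < e -> exists y, 0 < d x y < e).
  have /choice[F FP] e : exists y, 0 < e -> 0 < d x y < e.
    have [e0|e0] := pselect (0 < e); last by exists x.
    by have [y] := xP e e0; exists y.
  pose p := fix p n := if n is m.+1 then F (d x (p m) / 2) else F 1.
  have p0 n : 0 < d x (p n).
    elim: n => [|n IHn]; first by case/andP: (FP 1 ltr01).
    by have /FP/andP[] : 0 < d x (p n) / 2 by lra.
  have pS n : d x (p n.+1) < d x (p n) / 2.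
    have /FP/andP[_] // : 0 < d x (p n) / 2 by have := p0 n; lra.
  have pD n k : d x (p (n + k.+1)%N) < d x (p n) / 2.
    elim: k => [|k IHk]; first by rewrite addn1; exact: pS.
    rewrite addnS; have := pS (n + k.+1)%N; have := p0 (n + k.+1)%N; lra.
  exists p, (fun n => [set y | d x (p n) / 2 < d x y < 2 * d x (p n)]).
  split=> [n|n m].
    apply/dX => y /= /andP[y1 y2].
    exists (Num.min (d x y - d x (p n) / 2) (2 * d x (p n) - d x y)).
      by rewrite lt_min; apply/andP; split; lra.
    move=> z /=; rewrite lt_min => /andP[z1 z2].
    have := dtri x y z; have := dtri x z y; rewrite (dsym z y) => *.
    by apply/andP; split; lra.
  split=> [/= /andP[nm mn]|->]; last first.
    by have := p0 m => /= *; apply/andP; split; lra.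
  have [lt|lt|//] := ltngtP n m.
  - have e : (n + (m - n.+1).+1)%N = m by lia.
    by have H := pD n (m - n.+1)%N; exfalso; move: H; rewrite e; lra.
  - have e : (m + (n - m.+1).+1)%N = n by lia.
    by have H := pD m (n - m.+1)%N; exfalso; move: H; rewrite e; lra.
have /type_card_leP[p pI] := (infiniteP _).1 Xinf.
exists p, (fun n => [set p n]); split=> [n|n m]; last by split=> [/pI|->].
apply/dX => _ ->; have /forallNP/(_ (p n))/existsNP[e /not_implyP[e0 ne]] := iso.
exists e => // y /= ye; apply: contrapT => yp; apply: ne; exists y; rewrite ye andbT.
by rewrite lt0r dge0 andbT; apply/eqP => /d0 /esym.
Qed.

(** The large fiber of [i \o f] is nonempty, so its color is the image of a color in [C]. *)
Lemma full_fiber_inj (C D K : Type) (i : C -> D) :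
  injective i -> infinite_set [set: K] ->
  (forall f : K -> D, exists c, [set k | f k = c] #= [set: K]) ->
  forall f : K -> C, exists c, [set k | f k = c] #= [set: K].
Proof.
move=> iI Kinf fib f; have [c fc] := fib (i \o f).
have [k0 k0c] : [set k | (i \o f) k = c] !=set0.
  apply: infinite_setN0 => ffin; apply: Kinf; apply: card_le_finite ffin.
  by have /card_eqPle[] := fc.
exists (f k0); suff -> : [set k | f k = f k0] = [set k | (i \o f) k = c] by [].
by apply/seteqP; split=> k /=; rewrite -k0c /=; [move=> ->|move=> /iI].
Qed.

(** In the compact case, [nat]-colorings link both sides: [X] has a discrete sequence and [CL X] a
    countable network. Otherwise [w(X)^+], which is at most [2^omega], distinguishes the two
    classes. *)
Lemma compact_SC_CL (R : realType) (X : topologicalType) :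
  infinite_set [set: X] -> metrizable R X ->
  [set: weight X] #= [set: nat] -> (compact [set: X] <-> SC X = SC (CL X)).
Proof.
move=> Xinf [d dm dX] /card_eqPle[wnat natw].
have winf : infinite_set [set: weight X] by apply/infiniteP.
have [N oN netN] := weight_network wnat.
split=> [cX|SCE].
  apply/funext => K; apply/propext; split; last exact: SC_CL (metric_closed1 dm dX).
  move=> [Kinf scK]; split=> //.
  have [M netM] := compact_CL_network cX oN netN.
  have [p [V [oV Vp]]] := infinite_metric_discrete_sequence dm dX Xinf.
  apply: (super_caliber_network netM).
  apply: (full_fiber_inj (pcan_inj pickleK) Kinf).
  exact: (super_caliber_fiber oV Vp Kinf scK).
apply: contrapT => ncX.
have [p pI clp] := not_compact_closed_sequence (metric_closed1 dm dX) oN netN ncX.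
have := SC_card_succ_weight winf; rewrite SCE => -[_].
apply: (not_super_caliber_CL pI clp infinite_nat (infinite_card_succ winf)).
apply: card_succ_le; exact: card_le_lt_trans wnat (card_lt_set nat).
Qed.

(** * The beth numbers and the space of part (4) *)

Fixpoint beth (n : nat) : Type := if n is m.+1 then set (beth m) else nat.

Definition beth_omega : Type := {n : nat & beth n}.

Lemma beth_le m n : (m <= n)%N -> [set: beth m] #<= [set: beth n].
Proof.
elim: n => [|n IHn]; first by rewrite leqn0 => /eqP->; exact: card_lexx.
rewrite leq_eqVlt => /predU1P[->|/IHn mn]; first exact: card_lexx.
by apply: card_le_trans mn _; case: (card_lt_set (beth n)).
Qed.

Lemma beth_infinite n : infinite_set [set: beth n].
Proof. by apply/infiniteP; exact: (@beth_le 0). Qed.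

Lemma beth_lt_omega n : [set: beth n] #< [set: beth_omega].
Proof.
apply/card_ltNge => omegan; have /card_ltNge := card_lt_set (beth n); apply.
apply: card_le_trans omegan; apply/type_card_leP.
by exists (existT beth n.+1) => A B; exact: eq_from_Tagged.
Qed.

Lemma beth_omega_infinite : infinite_set [set: beth_omega].
Proof. by apply/infiniteP; case: (beth_lt_omega 0). Qed.

(* The sum of the discrete spaces [beth n] together with a point at infinity
   [None] to which they converge. *)
Definition beth_space : Type := option beth_omega.

HB.instance Definition _ := gen_eqMixin beth_space.
HB.instance Definition _ := gen_choiceMixin beth_space.

Definition beth_open (A : set beth_space) : Prop :=
  A None -> exists m : nat, forall s : beth_omega, (m <= projT1 s)%N -> A (Some s).

Lemma beth_openT : beth_open setT.
Proof. by exists 0%N. Qed.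

Lemma beth_openI (A B : set beth_space) :
  beth_open A -> beth_open B -> beth_open (A `&` B).
Proof.
move=> oA oB [/oA[m Am] /oB[n Bn]]; exists (maxn m n) => s.
by rewrite geq_max => /andP[/Am ? /Bn].
Qed.

Lemma beth_open_bigU (I : Type) (f : I -> set beth_space) :
  (forall i, beth_open (f i)) -> beth_open (\bigcup_i f i).
Proof.
by move=> of' [i _ /of'[m fm]]; exists m => s /fm; exists i.
Qed.

HB.instance Definition _ :=
  isOpenTopological.Build beth_space beth_openT beth_openI beth_open_bigU.

Lemma beth_openE (A : set beth_space) : open A <-> beth_open A.
Proof. by []. Qed.

Lemma open_Some (s : beth_omega) : open ([set Some s] : set beth_space).
Proof. by apply/beth_openE. Qed.

Definition beth_tail (m : nat) : set beth_space :=
  [set y | if y is Some s then (m <= projT1 s)%N else True].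

Lemma open_beth_tail m : open (beth_tail m).
Proof. by apply/beth_openE => _; exists m. Qed.

Section ultrametric.
Variable R : realType.

Let radius (y : beth_space) : R :=
  if y is Some s then (projT1 s).+1%:R^-1 else 0.

Let radius_ge0 y : 0 <= radius y.
Proof. by case: y => [s|] //=; rewrite invr_ge0. Qed.

Let radius_gt0 s : 0 < radius (Some s).
Proof. by rewrite /= invr_gt0. Qed.

(** [radius] is the distance to [None]; distinct points are as far apart as the farther of them is
    from [None]. *)
Definition beth_dist (x y : beth_space) : R :=
  if x == y then 0 else Num.max (radius x) (radius y).

Lemma beth_dist_ultrametric : is_ultrametric beth_dist.
Proof.
have dC x y : beth_dist x y = beth_dist y x by rewrite /beth_dist maxC eq_sym.
have dge0 x y : 0 <= beth_dist x y.
  by rewrite /beth_dist; case: ifP => // _; rewrite le_max radius_ge0.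
have dmax x y z : beth_dist x z <= Num.max (beth_dist x y) (beth_dist y z).
  rewrite {1}/beth_dist; case: eqVneq => [_|xz]; first by rewrite le_max dge0.
  rewrite /beth_dist; case: (eqVneq x y) xz => [->|xy] xz.
    by rewrite (negbTE xz) le_max lexx orbT.
  case: (eqVneq y z) => [<-|yz]; first by rewrite le_max lexx.
  by rewrite ge_max !le_max !lexx !orbT.
split; last exact: dmax.
split=> // [x y|x y z].
  split=> [|->]; last by rewrite /beth_dist eqxx.
  rewrite /beth_dist; case: eqVneq => // xy /eqP.
  case: x y xy => [s|] [t|] // _; rewrite eq_le ge_max => /andP[/andP[]].
  - by rewrite leNgt radius_gt0.
  - by rewrite leNgt radius_gt0.
  - by rewrite (leNgt (radius (Some t))) radius_gt0.
apply: le_trans (dmax x y z) _.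
by rewrite ge_max lerDl dge0 lerDr dge0.
Qed.

Lemma beth_dist_induces : induces_topology beth_dist.
Proof.
move=> A; rewrite beth_openE; split=> [oA [s|] Ax|oA ANone].
(* Every other point is at least this far away, so the ball is a singleton. *)
- exists (radius (Some s)) => // y /=; rewrite /beth_dist.
  by case: eqVneq => [<-//|sy]; rewrite gt_max ltxx.
- have [m Am] := oA Ax; exists m.+1%:R^-1; first by rewrite invr_gt0.
  move=> [s|] //=; rewrite /beth_dist; case: eqVneq => // _; rewrite gt_max => /andP[_] /=.
  by rewrite ltf_pV2 ?posrE // ltr_nat ltnS => ms; exact/Am/ltnW.
- have [e e0 eA] := oA _ ANone.
  exists (Num.bound e^-1) => s ms; apply: eA => /=.
  rewrite /beth_dist; case: eqVneq => // _; rewrite gt_max /= e0 /=.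
  have e1 : 0 < e^-1 by rewrite invr_gt0.
  rewrite invf_plt ?posrE ?ltr0n //.
  apply: lt_le_trans (archi_boundP (ltW e1)) _.
  by rewrite ler_nat; exact: leqW.
Qed.

Lemma beth_space_ultrametrizable : ultrametrizable R beth_space.
Proof.
by exists beth_dist; [exact: beth_dist_ultrametric|exact: beth_dist_induces].
Qed.

End ultrametric.

(** Singletons of isolated points and tails form a base, and every base contains those
    singletons. *)
Lemma weight_beth_space : [set: weight beth_space] #= [set: beth_omega].
Proof.
apply/card_eqPle; split.
  pose b (u : beth_omega * bool) : set beth_space :=
    if u.2 then [set Some u.1] else beth_tail (projT1 u.1).
  have mul : [set: beth_omega * bool] #<= [set: beth_omega].
    exact: card_sqr_bool beth_omega_infinite (card_sqr_le beth_omega_infinite).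
  apply: (@weight_le _ _ (range b)).
    split=> [_ [u _ <-]|x U].
      by rewrite /b; case: ifP => _; [exact: open_Some|exact: open_beth_tail].
    rewrite nbhsE => -[V [/beth_openE oV Vx] VU].
    case: x Vx => [s|] Vx.
      by exists [set Some s] => [|_ ->]; [split=> //; exists (s, true)|exact: VU].
    (* Any [t0] at level [m] serves to index [beth_tail m]. *)
    have [m Vm] := oV Vx; have [t0 _] := infinite_setN0 (@beth_infinite m).
    exists (beth_tail m); first by split=> //; exists (existT _ m t0, false).
    by move=> [s|] ms; apply: VU => //; exact: Vm.
  exact: card_le_trans (card_image_le b setT) mul.
have [[B [oB xB] /card_eqPle[_ wB]] _] := weightP beth_space.
apply: card_le_trans wB; apply/card_leTP.
exists (fun s => [set Some s]) => [s t st|s].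
  by have : [set Some t] (Some s); [rewrite -st|move=> []].
have [|V [BV Vs] VU] := xB (Some s) [set Some s].
  by apply: open_nbhs_nbhs; split=> //; exact: open_Some.
suff -> : [set Some s] = V by [].
by apply/seteqP; split=> // _ ->.
Qed.

(** The levels cut [beth_omega] into countably many smaller pieces. *)
Lemma cofinality_weight_beth_space :
  [set: cofinality (weight beth_space)] #= [set: nat].
Proof.
have /card_eqPle[/type_card_leP[i iI] omegaw] := weight_beth_space.
have winf := infinite_card_le beth_omega_infinite omegaw.
apply/card_eqPle; split; last exact: cofinality_infinite.
apply: (@cofinality_le_nat _ (fun x => projT1 (i x))) => // n.
apply/card_ltNge => wn.
have /card_ltNge := beth_lt_omega n; apply.
apply: card_le_trans omegaw _; apply: card_le_trans wn _.
have /choice[h hP] (x : set_type [set x | projT1 (i x) = n]) :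
    exists y : beth n, i (val x) = existT _ n y.
  by case: x => x /= /set_mem/= <-; exists (projT2 (i x)); case: (i x).
apply: (card_le_trans (B := [set: set_type [set x | projT1 (i x) = n]])).
  by have /card_eqPle[] := card_setT [set x | projT1 (i x) = n].
apply/type_card_leP; exists h => x y xy; apply/val_inj/iI.
by rewrite !hP xy.
Qed.

(** [None] belongs to every head, so a trace on a head records whether a set contains it. *)
Definition beth_head (m : nat) : set beth_space :=
  [set y | if y is Some s then (projT1 s < m)%N else True].

Lemma beth_head_embedding m :
  exists e : beth_space -> beth m, {in beth_head m &, injective e}.
Proof.
have minf := @beth_infinite m; have [z0 _] := infinite_setN0 minf.
have /type_card_leP[q qI] : [set: nat * beth m] #<= [set: beth m].
  by apply: card_mul_le => //; exact: (@beth_le 0).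
have j k : {j : beth k -> beth m | (k < m)%N -> injective j}.
  apply: cid; have [km|_] := boolP (k < m)%N; last by exists (fun=> z0).
  by have /type_card_leP[j jI] := beth_le (ltnW km); exists j.
(* Levels are shifted by one to reserve 0 for [None]. *)
exists (fun y => q (if y is Some s
                    then ((projT1 s).+1, sval (j _) (projT2 s)) else (0%N, z0))).
move=> [[k x]|] [[l y]|] // /set_mem/= km /set_mem/= lm /qI//= [kl].
by move: y lm; rewrite -kl => y _ /(svalP (j k) km)->.
Qed.

(* Whether [C] belongs to a small neighborhood of [A] depends only on the trace
   of [C] on a large [beth_head m], which has only [beth m.+1] subsets. *)
Lemma CL_beth_network : exists N : beth_omega -> set (CL beth_space),
  forall A W, open W -> W A -> exists2 c, N c A & N c `<=` W.
Proof.
pose e m := projT1 (cid (beth_head_embedding m)).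
have eI m : {in beth_head m &, injective (e m)} := projT2 (cid (beth_head_embedding m)).
pose code m (A : set beth_space) : beth_omega :=
  existT beth m.+1 (e m @` (A `&` beth_head m)).
have codeI m n A C : code m A = code n C ->
    m = n /\ A `&` beth_head m = C `&` beth_head m.
  move=> /[dup] /(congr1 (@projT1 _ _))[<-] /(@eq_from_Tagged _ beth) imE; split=> //.
  have sub S T : e m @` (S `&` beth_head m) = e m @` (T `&` beth_head m) ->
      S `&` beth_head m `<=` T.
    move=> ST x [Sx mx].
    have [y [Ty my] yx] : (e m @` (T `&` beth_head m)) (e m x).
      by rewrite -ST; exists x.
    by rewrite -(eI m y x (mem_set my) (mem_set mx) yx).
  apply/seteqP; split=> x [Sx mx]; split=> //.
    exact: (sub _ _ imE).
  exact: (sub _ _ (esym imE)).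
(* Points of [C] beyond the head are invisible to the code. They are allowed only when [C] contains
   [None], and then some [U i] will contain the whole tail. *)
exists (fun c => [set C : CL beth_space | exists m,
  c = code m (CL_set C) /\ (CL_set C None \/ CL_set C `<=` beth_head m)]).
move=> A W oW WA; have [n [U [oU [AU AUi] UW]]] := open_CL_vietoris oW WA.
have beth_head_le m m' : (m <= m')%N -> beth_head m `<=` beth_head m'.
  by move=> mm' [s|] //= /leq_trans; apply.
have /choice[t tP] i : exists x, (CL_set A `&` U i) x by exact: AUi.
have /choice[r rP] i : exists m, beth_head m (t i).
  by case: (t i) => [s|]; [exists (projT1 s).+1; exact: ltnSn|exists 0%N].
have [m0 m0P] : exists m, (CL_set A None -> exists i, beth_tail m `<=` U i) /\
    (~ CL_set A None -> CL_set A `<=` beth_head m).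
  have [ANone|nANone] := pselect (CL_set A None).
    have [i _ UNone] := AU _ ANone; have [m mU] := (beth_openE _).1 (oU i) UNone.
    by exists m; split=> // _; exists i => -[s|] //; exact: mU.
  have /beth_openE oA : open (~` CL_set A) by apply: closed_openC; exact: CL_closed.
  have [m mA] := oA nANone; exists m; split=> // _ [s|] //= As.
  by rewrite ltnNge; apply/negP => /mA.
(* The head of level [m] contains a witness [t i] for every [U i], and [m] passes the bound [m0]
   that controls the tail. *)
pose m := maxn m0 (\max_i r i).
have tm i : beth_head m (t i).
  by apply: beth_head_le (rP i); rewrite leq_max leq_bigmax orbT.
have m0m : (m0 <= m)%N by rewrite leq_maxl.
exists (code m (CL_set A)).
  exists m; split=> //; have [|/m0P.2 Am0] := pselect (CL_set A None); first by left.
  by right=> x /Am0; exact: beth_head_le.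
move=> C [m' [/codeI[<- ACm] Cor]]; apply: UW.
have AC x : beth_head m x -> CL_set A x <-> CL_set C x.
  move=> mx; split=> Hx.
    by have [] : (CL_set C `&` beth_head m) x by rewrite -ACm.
  by have [] : (CL_set A `&` beth_head m) x by rewrite ACm.
split=> [x Cx|i]; last first.
  by have [At Ut] := tP i; exists (t i); split=> //; apply/AC.
have [mx|nmx] := pselect (beth_head m x); first by apply: AU; apply/AC.
case: Cor => [CNone|/(_ _ Cx)//].
have /m0P.1[i tU] : CL_set A None by apply/AC.
exists i => //; apply: tU; case: x Cx nmx => //= s _ /negP; rewrite -leqNgt.
exact: leq_trans.
Qed.

(** Colorings by [beth_omega] link both sides: the isolated points form a discrete family of that
    size, and [CL] has a network of that size. *)
Lemma SC_beth_space (R : realType) : SC beth_space = SC (CL beth_space).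
Proof.
have [d [dm _] dX] := beth_space_ultrametrizable R.
apply/funext => K; apply/propext; split; last exact: SC_CL (metric_closed1 dm dX).
move=> [Kinf scK]; split=> //; have [N netN] := CL_beth_network.
apply: (super_caliber_network netN).
have Sp (s t : beth_omega) : [set Some s : beth_space] (Some t) <-> s = t.
  by split=> [[->]|->].
exact: (super_caliber_fiber open_Some Sp Kinf scK).
Qed.

Theorem theorem5p12 (R : realType) :
  (forall X : topologicalType, infinite_set [set: X] -> metrizable R X ->
     [/\ [set: weight X] #= [set: nat] ->
           (compact [set: X] <-> SC X = SC (CL X)),
         [set: nat] #< [set: cofinality (weight X)] ->
           SC X (card_succ (weight X)) /\ ~ SC (CL X) (card_succ (weight X)) &
         [set: nat] #< [set: weight X] ->
         [set: cofinality (weight X)] #= [set: nat] ->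
         [set: weight X] #< [set: set nat] ->
           SC X (card_succ (weight X)) /\ ~ SC (CL X) (card_succ (weight X))]) /\
  (exists Y : topologicalType,
     [/\ ultrametrizable R Y,
         [set: nat] #< [set: weight Y],
         [set: cofinality (weight Y)] #= [set: nat] &
         GCH -> SC Y = SC (CL Y)]).
Proof.
split=> [X Xinf mX|].
  have [d dm dX] := mX; split; first exact: compact_SC_CL mX.
  - move=> cofw; split; last exact: (not_SC_cofinality_gt dm dX cofw).
    apply: SC_card_succ_weight; apply/infiniteP.
    by apply: card_le_trans (cofinality_le _); case: cofw.
  - move=> natw _ wc; split; last exact: (not_SC_weight_lt_continuum dm dX natw wc).
    by apply: SC_card_succ_weight; apply/infiniteP; case: natw.
exists beth_space; split.
- exact: beth_space_ultrametrizable.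
- have /card_eqPle[_ omegaw] := weight_beth_space.
  apply/card_ltNge => wnat; have /card_ltNge := beth_lt_omega 0; apply.
  exact: card_le_trans omegaw wnat.
- exact: cofinality_weight_beth_space.
- by move=> _; exact: SC_beth_space.
Qed.
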